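(* Let $\mathbb{K}$ be a commutative ring and let $V$ be a $\mathbb{K}$-module. Then the precoalgebra $(\mathrm{Rep}(V),\delta,\varepsilon)$, equipped with the homomorphism $\pi\colon \mathrm{Rep}(V)\to V$, is cofree over $V$. That is, for any precoalgebra $(D,\delta',\varepsilon')$ and any homomorphism $\varphi\colon D\to V$ there exists a unique precoalgebra morphism $\tilde\varphi\colon D\to \mathrm{Rep}(V)$ such that $\pi\circ\tilde\varphi=\varphi$.
   Context: All modules, homomorphisms and tensor products are over a fixed commutative ring $\mathbb{K}$ (not necessarily a field). Precoalgebras. A precoalgebra is a module $C$ with homomorphisms $\delta\colon C\to C\otimes C$ and $\varepsilon\colon C\to\mathbb{K}$, with no further conditions. A precoalgebra morphism $\varphi\colon (D,\delta',\varepsilon')\to (C,\delta,\varepsilon)$ is a homomorphism with $\delta\circ\varphi=(\varphi\otimes\varphi)\circ\delta'$ and $\varepsilon\circ\varphi=\varepsilon'$. Grading trees. A grading tree is a finite full (ordered, rooted) binary tree: every node has exactly zero or two children (a left one and a right one). $\bullet$ is the one-node tree, and $t\wedge u$ is the tree obtained by adding a new root whose left and right subtrees are $t$ and $u$. $\mathrm{leaf}(t)$ is the number of leaves. Tree-tensor algebra. For a module $W$ put $\hat T^tW=W^{\otimes \mathrm{leaf}(t)}$ for each grading tree $t$ and $\hat T W=\bigoplus_t \hat T^tW$ (the sum is over all grading trees). The product $\hat\otimes\colon \hat T^tW\otimes\hat T^uW\to\hat T^{t\wedge u}W$ is concatenation of tensors. $\hat T\mathbb{K}$ is identified with the free module on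 the set of grading trees (since $\hat T^t\mathbb{K}\cong\mathbb{K}$), so a homomorphism $f$ out of $\hat T\mathbb{K}$ is determined by its values $f(t)$ on grading trees. A homomorphism $f\colon\hat T\mathbb{K}\to\hat T W$ is tree-graded if $f(t)\in\hat T^tW$ for all $t$. Generating trees. A generating tree for $V$ is an infinite ordered rooted tree $\sigma$ such that each node has a finite even number $2n\ge 2$ of children ($n$ may depend on the node), named $\mathrm{L}(1),\dots,\mathrm{L}(n),\mathrm{R}(1),\dots,\mathrm{R}(n)$ from left to right, and each node is labelled by an element of $V\oplus\mathbb{K}$. A node is specified by a finite sequence $r$ of symbols $\mathrm{L}(i),\mathrm{R}(i)$ read from the root (a position sequence; the root is the empty sequence $\emptyset$). $\sigma\langle r\rangle$ is the label at node $r$. Generated homomorphisms. For a grading tree $t$ with leaves $p_1,\dots,p_n$ from left to right, write $p_k=\xi_{k,1}\cdots\xi_{k,m_k}$ with each $\xi_{k,l}\in\{\mathrm{L},\mathrm{R}\}$ (the path from the root). To each inner node $q$ of $t$ (also a word in $\mathrm{L},\mathrm{R}$) assign a variable $\iota\langle q\rangle$ ranging over positive integers and put $r_k=\xi_{k,1}(\iota\langle\emptyset\rangle)\,\xi_{k,2}(\iota\langle\xi_{k,1}\rangle)\cdots\xi_{k,m_k}(\iota\langle\xi_{k,1}\cdots\xi_{k,m_k-1}\rangle)$. The homomorphism $f\colon\hat T\mathbb{K}\to\hat T(V\oplus\mathbb{K})$ generated by $\sigma$ is the tree-graded homomorphism with $f(\bullet)=\sigma\langle\emptyset\rangle$ and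 $f(t)=\sum_\iota \sigma\langle r_1\rangle\otimes\cdots\otimes\sigma\langle r_n\rangle\in\hat T^t(V\oplus\mathbb{K})$, the (finite) sum being over all assignments $\iota$ such that every $r_k$ specifies a node of $\sigma$. A homomorphism $\hat T\mathbb{K}\to\hat T(V\oplus\mathbb{K})$ is representative if it is generated by some generating tree for $V$; $\mathrm{Rep}(V)\subseteq\mathrm{Hom}(\hat T\mathbb{K},\hat T(V\oplus\mathbb{K}))$ is the set (a submodule) of all representative homomorphisms. Structure maps. For $f\in\mathrm{Rep}(V)$ choose finite families $(g_i)_{i\in I},(h_i)_{i\in I}$ in $\mathrm{Rep}(V)$ with $f(t\wedge u)=\sum_{i\in I} g_i(t)\mathbin{\hat\otimes}h_i(u)$ for all grading trees $t,u$, and put $\delta(f)=\sum_{i\in I} g_i\otimes h_i\in\mathrm{Rep}(V)\otimes\mathrm{Rep}(V)$; such families exist (if $\sigma$ generates $f$, take the homomorphisms generated by the subtrees of $\sigma$ at $\mathrm{L}(i)$ and at $\mathrm{R}(i)$), and the result is independent of the choice, so this gives a homomorphism $\delta$. Also $\varepsilon(f)$ is the $\mathbb{K}$-component of $f(\bullet)\in V\oplus\mathbb{K}$ and $\pi(f)$ is the $V$-component of $f(\bullet)$.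
   Formalization: The formal theorem assumes that δ(f) is independent of the chosen families (g_i), (h_i), which the context asserts for all K and V; this fails e.g. for K = ℤ, V = ℚ/ℤ, where δ is not well defined and Rep(V) is not cofree. *)

(* Defs.v *)
From HB Require Import structures.
From mathcomp Require Import all_boot all_algebra.
From mathcomp Require Import generic_quotient.
From mathcomp Require Import boolp classical_sets functions fsbigop.

Set Implicit Arguments.
Unset Strict Implicit.
Unset Printing Implicit Defensive.

Import GRing.Theory.
Local Open Scope ring_scope.
Local Open Scope quotient_scope.

(* The K-module with generators G and relations s = t for [rel s t], where a
   formal combination of generators is a list of pairs (coefficient, generator).
   Tensor products and tensor powers are obtained from it. *)
Section Presentation.
Variables (K : comPzRingType) (G : choiceType).
Implicit Types s t : seq (K * G).

Definition fscale (a : K) s := [seq (a * p.1, p.2) | p <- s].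

Inductive pres_eq (rel : seq (K * G) -> seq (K * G) -> Prop) :
    seq (K * G) -> seq (K * G) -> Prop :=
| pres_rel s t : rel s t -> pres_eq rel s t
| pres_add a b g : pres_eq rel [:: (a, g); (b, g)] [:: (a + b, g)]
| pres_zero g : pres_eq rel [:: (0, g)] [::]
| pres_catC s t : pres_eq rel (s ++ t) (t ++ s)
| pres_cat s s' t t' :
    pres_eq rel s s' -> pres_eq rel t t' -> pres_eq rel (s ++ t) (s' ++ t')
| pres_scale a s t :
    pres_eq rel s t -> pres_eq rel (fscale a s) (fscale a t)
| pres_refl s : pres_eq rel s s
| pres_sym s t : pres_eq rel s t -> pres_eq rel t s
| pres_trans s t u : pres_eq rel s t -> pres_eq rel t u -> pres_eq rel s u.

Variable rel : seq (K * G) -> seq (K * G) -> Prop.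

Definition pres_eqb s t := `[< pres_eq rel s t >].

Lemma pres_eqb_refl : reflexive pres_eqb.
Proof. by move=> s; apply/asboolP/pres_refl. Qed.
Lemma pres_eqb_sym : symmetric pres_eqb.
Proof. by move=> s t; apply/asboolP/asboolP; apply: pres_sym. Qed.
Lemma pres_eqb_trans : transitive pres_eqb.
Proof.
move=> t s u /asboolP st /asboolP tu; apply/asboolP; exact: pres_trans st tu.
Qed.

Canonical pres_equiv :=
  EquivRel pres_eqb pres_eqb_refl pres_eqb_sym pres_eqb_trans.

Definition pres := {eq_quot pres_equiv}.
HB.instance Definition _ := Choice.on pres.
HB.instance Definition _ := EqQuotient.on pres.

Definition fclass s : pres := \pi_pres s.

Lemma fclassW (P : pres -> Prop) : (forall s, P (fclass s)) -> forall x, P x.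
Proof. by move=> Ps x; rewrite -[x]reprK; apply: Ps. Qed.

Lemma fclass_eq s t : pres_eq rel s t -> fclass s = fclass t.
Proof. by move=> st; apply/eqmodP/asboolP. Qed.

Lemma repr_fclass s : pres_eq rel (repr (fclass s)) s.
Proof. by have := reprK (fclass s) => /eqmodP/asboolP. Qed.

Definition pres0 : pres := fclass [::].
Definition presD (x y : pres) : pres := fclass (repr x ++ repr y).
Definition presZ a (x : pres) : pres := fclass (fscale a (repr x)).
Definition presN := presZ (-1).

Lemma presDE s t : presD (fclass s) (fclass t) = fclass (s ++ t).
Proof. by apply: fclass_eq; apply: pres_cat; apply: repr_fclass. Qed.
Lemma presZE a s : presZ a (fclass s) = fclass (fscale a s).
Proof. by apply: fclass_eq; apply: pres_scale; apply: repr_fclass. Qed.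

Lemma fscale_addl a b s :
  pres_eq rel (fscale (a + b) s) (fscale a s ++ fscale b s).
Proof.
elim: s => [|[c g] s IH] /=; first by apply: pres_refl.
apply: (@pres_trans _ _ ([:: (a * c, g); (b * c, g)]
                         ++ (fscale a s ++ fscale b s))).
  apply: (@pres_cat _ [:: _]) => //; apply: pres_sym.
  rewrite mulrDl; exact: pres_add.
apply: (@pres_cat _ [:: _] [:: _]); first by apply: pres_refl.
rewrite -[_ :: (_ ++ _)]/([:: (b * c, g)] ++ _) -[_ :: fscale b s]cat1s.
rewrite !catA; apply: pres_cat; [exact: pres_catC|exact: pres_refl].
Qed.

Lemma fscale0 s : pres_eq rel (fscale 0 s) [::].
Proof.
elim: s => [|[c g] s IH] /=; first by apply: pres_refl.
apply: (@pres_cat _ [:: _] [::]) => //; rewrite mul0r; exact: pres_zero.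
Qed.

Lemma fscale1 s : fscale 1 s = s.
Proof.
by rewrite /fscale -[RHS]map_id; apply: eq_map => -[a g]; rewrite mul1r.
Qed.

Lemma presDA : associative presD.
Proof.
elim/fclassW => s; elim/fclassW => t; elim/fclassW => u.
by rewrite !presDE catA.
Qed.
Lemma presDC : commutative presD.
Proof.
elim/fclassW => s; elim/fclassW => t.
rewrite !presDE; exact/fclass_eq/pres_catC.
Qed.
Lemma pres0D : left_id pres0 presD.
Proof. by elim/fclassW => s; rewrite presDE. Qed.
Lemma presND : left_inverse pres0 presN presD.
Proof.
elim/fclassW => s; rewrite /presN presZE presDE; apply: fclass_eq.
apply: (@pres_trans _ _ (fscale (-1 + 1) s)).
  by apply: pres_sym; rewrite -{3}[s]fscale1; exact: fscale_addl.
rewrite addNr; exact: fscale0.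
Qed.

HB.instance Definition _ :=
  GRing.isZmodule.Build pres presDA presDC pres0D presND.

Lemma fclass_cat s t : fclass (s ++ t) = fclass s + fclass t.
Proof. by rewrite -presDE. Qed.

Lemma presZA a b (x : pres) : presZ a (presZ b x) = presZ (a * b) x.
Proof.
elim/fclassW: x => s; rewrite !presZE /fscale -map_comp; congr fclass.
by apply: eq_map => p /=; rewrite mulrA.
Qed.
Lemma pres1Z : left_id 1 presZ.
Proof. by elim/fclassW => s; rewrite presZE fscale1. Qed.
Lemma presZDr : right_distributive presZ +%R.
Proof.
move=> a; elim/fclassW => s; elim/fclassW => t.
by rewrite -fclass_cat !presZE -fclass_cat /fscale map_cat.
Qed.
Lemma presZDl (v : pres) : {morph presZ^~ v : a b / a + b}.
Proof.
move=> a b; elim/fclassW: v => s; rewrite !presZE -fclass_cat.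
exact/fclass_eq/fscale_addl.
Qed.

HB.instance Definition _ :=
  GRing.Zmodule_isLmodule.Build K pres presZA pres1Z presZDr presZDl.

Lemma fclass_scale a s : fclass (fscale a s) = a *: fclass s.
Proof. by rewrite -presZE. Qed.

Definition pgen (g : G) : pres := fclass [:: (1, g)].

Lemma fclassE s : fclass s = \sum_(p <- s) p.1 *: pgen p.2.
Proof.
elim: s => [|[a g] s IH]; first by rewrite big_nil.
by rewrite big_cons -IH -fclass_scale -fclass_cat /= mulr1.
Qed.

Section Lift.
Variables (P : lmodType K) (F : G -> P).

Definition flift s : P := \sum_(p <- s) p.1 *: F p.2.

(* The linear extension of F; meaningful when F respects the relations. *)
Definition plift (x : pres) : P := flift (repr x).

Hypothesis F_rel : forall s t, rel s t -> flift s = flift t.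

Lemma flift_cat s t : flift (s ++ t) = flift s + flift t.
Proof. exact: big_cat. Qed.
Lemma flift_scale a s : flift (fscale a s) = a *: flift s.
Proof.
rewrite /flift big_map scaler_sumr; apply: eq_bigr => p _ /=.
by rewrite scalerA.
Qed.

Lemma flift_eq s t : pres_eq rel s t -> flift s = flift t.
Proof.
elim=> {s t} //.
- by move=> a b g; rewrite /flift !big_cons !big_nil !addr0 scalerDl.
- by move=> g; rewrite /flift big_cons !big_nil scale0r addr0.
- by move=> s t; rewrite !flift_cat addrC.
- by move=> s s' t t' _ ss' _ tt'; rewrite !flift_cat ss' tt'.
- by move=> a s t _ st; rewrite !flift_scale st.
- by move=> s t u _ -> _ ->.
Qed.

Lemma plift_fclass s : plift (fclass s) = flift s.
Proof. exact/flift_eq/repr_fclass. Qed.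

Lemma plift_linear : linear plift.
Proof.
move=> a; elim/fclassW => s; elim/fclassW => t.
by rewrite -fclass_scale -fclass_cat !plift_fclass flift_cat flift_scale.
Qed.

Lemma plift_gen g : plift (pgen g) = F g.
Proof. by rewrite plift_fclass /flift big_cons big_nil addr0 scale1r. Qed.

End Lift.

Lemma pres_ext (P : lmodType K) (f g : pres -> P) :
  linear f -> linear g -> (forall x, f (pgen x) = g (pgen x)) -> f =1 g.
Proof.
move=> lf lg fg.
have ev h s : linear h -> h (fclass s) = \sum_(p <- s) p.1 *: h (pgen p.2) :> P.
  move=> lh; rewrite fclassE.
  pose h' := HB.pack_for {linear pres -> P} h (GRing.isLinear.Build _ _ _ _ h lh).
  rewrite -[h]/(h' : _ -> _) linear_sum; apply: eq_bigr => p _.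
  by rewrite linearZ.
elim/fclassW => s; rewrite !ev //; apply: eq_bigr => p _.
by rewrite fg.
Qed.

End Presentation.

Section Tensor.
Variable K : comPzRingType.

Inductive tensor_rel (M N : lmodType K) :
    seq (K * (M * N)) -> seq (K * (M * N)) -> Prop :=
| tensor_relDl m m' n :
    tensor_rel [:: (1, (m + m', n))] [:: (1, (m, n)); (1, (m', n))]
| tensor_relDr m n n' :
    tensor_rel [:: (1, (m, n + n'))] [:: (1, (m, n)); (1, (m, n'))]
| tensor_relZl a m n : tensor_rel [:: (1, (a *: m, n))] [:: (a, (m, n))]
| tensor_relZr a m n : tensor_rel [:: (1, (m, a *: n))] [:: (a, (m, n))].

Definition tensor (M N : lmodType K) : lmodType K := pres (@tensor_rel M N).

Definition tens (M N : lmodType K) (m : M) (n : N) : tensor M N :=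
  pgen (@tensor_rel M N) (m, n).

Definition tensor_map (M N M' N' : lmodType K) (f : M -> M') (g : N -> N')
  (z : tensor M N) : tensor M' N' :=
  plift (fun p : M * N => tens (f p.1) (g p.2)) z.

End Tensor.

Section TensorPower.
Variables (K : comPzRingType) (W : lmodType K).

Definition tsubst n (v : n.-tuple W) (i : 'I_n) (x : W) : n.-tuple W :=
  [tuple if j == i then x else tnth v j | j < n].

Inductive tpow_rel n : seq (K * n.-tuple W) -> seq (K * n.-tuple W) -> Prop :=
| tpow_relD v i x y : tpow_rel [:: (1, tsubst v i (x + y))]
    [:: (1, tsubst v i x); (1, tsubst v i y)]
| tpow_relZ v i a x :
    tpow_rel [:: (1, tsubst v i (a *: x))] [:: (a, tsubst v i x)].

Definition tpow n : lmodType K := pres (@tpow_rel n).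

Definition tpure n (v : n.-tuple W) : tpow n := pgen (@tpow_rel n) v.

(* Concatenation of tensors: the bilinear map sending
   (v_1 (x) ... (x) v_m, w_1 (x) ... (x) w_n) to
   v_1 (x) ... (x) v_m (x) w_1 (x) ... (x) w_n. *)
Definition tcat m n (x : tpow m) (y : tpow n) : tpow (m + n) :=
  plift (fun v : m.-tuple W =>
    plift (fun w : n.-tuple W => tpure (cat_tuple v w)) y) x.

(* The canonical isomorphism from the first tensor power to W. *)
Definition tpow1 (x : tpow 1) : W := plift (fun v : 1.-tuple W => thead v) x.

End TensorPower.

Section TensorTheory.
Variable K : comPzRingType.

Lemma flift1 (G : choiceType) (P : lmodType K) (F : G -> P) a g :
  flift F [:: (a, g)] = a *: F g.
Proof. by rewrite /flift big_seq1. Qed.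

Lemma flift2 (G : choiceType) (P : lmodType K) (F : G -> P) p q :
  flift F [:: p; q] = p.1 *: F p.2 + q.1 *: F q.2.
Proof. by rewrite /flift big_cons big_seq1. Qed.

Lemma pgen_rel (G : choiceType) rel s t :
  rel s t -> flift (@pgen K G rel) s = flift (@pgen K G rel) t.
Proof. by move=> st; rewrite /flift -!fclassE; apply/fclass_eq/pres_rel. Qed.

Lemma flift_lin (G : choiceType) (P : lmodType K) (F F' F'' : G -> P) a s :
  (forall g, F g = a *: F' g + F'' g) -> flift F s = a *: flift F' s + flift F'' s.
Proof.
move=> FE; rewrite /flift scaler_sumr -big_split; apply: eq_bigr => p _ /=.
by rewrite FE scalerDr !scalerA mulrC.
Qed.

Lemma tensDl (M N : lmodType K) m m' (n : N) :
  tens (m + m' : M) n = tens m n + tens m' n.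
Proof.
by have := pgen_rel (tensor_relDl m m' n); rewrite flift1 flift2 !scale1r.
Qed.
Lemma tensDr (M N : lmodType K) (m : M) (n n' : N) :
  tens m (n + n') = tens m n + tens m n'.
Proof.
by have := pgen_rel (tensor_relDr m n n'); rewrite flift1 flift2 !scale1r.
Qed.
Lemma tensZl (M N : lmodType K) a (m : M) (n : N) :
  tens (a *: m) n = a *: tens m n.
Proof. by have := pgen_rel (tensor_relZl a m n); rewrite !flift1 scale1r. Qed.
Lemma tensZr (M N : lmodType K) a (m : M) (n : N) :
  tens m (a *: n) = a *: tens m n.
Proof. by have := pgen_rel (tensor_relZr a m n); rewrite !flift1 scale1r. Qed.

Section TensorMap.
Variables (M N M' N' : lmodType K) (f : {linear M -> M'}) (g : {linear N -> N'}).

Let tensor_map_rel s t : @tensor_rel K M N s t ->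
  flift (fun p : M * N => tens (f p.1) (g p.2)) s =
  flift (fun p : M * N => tens (f p.1) (g p.2)) t.
Proof.
case=> *; rewrite flift1 ?flift2 ?flift1 !scale1r /= ?linearD ?linearZ /=.
- exact: tensDl.
- exact: tensDr.
- exact: tensZl.
- exact: tensZr.
Qed.

Lemma tensor_map_linear : linear (tensor_map f g).
Proof. by apply: plift_linear; exact: tensor_map_rel. Qed.

Lemma tensor_map_tens m n : tensor_map f g (tens m n) = tens (f m) (g n).
Proof. by rewrite /tensor_map plift_gen //; exact: tensor_map_rel. Qed.

End TensorMap.

Variable W : lmodType K.

Lemma tpureD n (v : n.-tuple W) i x y :
  tpure (tsubst v i (x + y)) = tpure (tsubst v i x) + tpure (tsubst v i y).
Proof.
by have := pgen_rel (tpow_relD v i x y); rewrite flift1 flift2 !scale1r.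
Qed.
Lemma tpureZ n (v : n.-tuple W) i a x :
  tpure (tsubst v i (a *: x)) = a *: tpure (tsubst v i x).
Proof. by have := pgen_rel (tpow_relZ v i a x); rewrite !flift1 scale1r. Qed.

Lemma cat_tsubstl m n (v : m.-tuple W) (w : n.-tuple W) i x :
  cat_tuple (tsubst v i x) w = tsubst (cat_tuple v w) (lshift n i) x.
Proof.
apply: eq_from_tnth => k; rewrite tnth_mktuple -[k]fintype.splitK.
case: (fintype.split k) => j /=.
  by rewrite !tnth_lshift tnth_mktuple (inj_eq (@lshift_inj _ _)).
by rewrite !tnth_rshift eq_rlshift.
Qed.
Lemma cat_tsubstr m n (v : m.-tuple W) (w : n.-tuple W) i x :
  cat_tuple v (tsubst w i x) = tsubst (cat_tuple v w) (rshift m i) x.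
Proof.
apply: eq_from_tnth => k; rewrite tnth_mktuple -[k]fintype.splitK.
case: (fintype.split k) => j /=.
  by rewrite !tnth_lshift eq_lrshift.
by rewrite !tnth_rshift tnth_mktuple (inj_eq (@rshift_inj _ _)).
Qed.

Let tcat_relr m n (v : m.-tuple W) s t : @tpow_rel K W n s t ->
  flift (fun w => tpure (cat_tuple v w)) s =
  flift (fun w => tpure (cat_tuple v w)) t.
Proof.
case=> *; rewrite flift1 ?flift2 ?flift1 !scale1r !cat_tsubstr.
  exact: tpureD.
exact: tpureZ.
Qed.

Let tcat_rell m n (y : tpow W n) s t : @tpow_rel K W m s t ->
  flift (fun v => plift (fun w => tpure (cat_tuple v w)) y) s =
  flift (fun v => plift (fun w => tpure (cat_tuple v w)) y) t.
Proof.
move=> st; elim/fclassW: y => u.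
have E r : flift (fun v : m.-tuple W =>
    plift (fun w : n.-tuple W => tpure (cat_tuple v w)) (fclass (@tpow_rel K W n) u)) r
  = \sum_(p <- r) p.1 *:
      \sum_(q <- u) q.1 *: tpure (cat_tuple p.2 q.2).
  by apply: eq_bigr => p _ /=; rewrite plift_fclass //; exact: tcat_relr.
rewrite !E; under eq_bigr do rewrite scaler_sumr.
under [RHS]eq_bigr do rewrite scaler_sumr.
rewrite exchange_big [RHS]exchange_big; apply: eq_bigr => q _ /=.
case: st => *; rewrite !big_cons !big_nil /= ?addr0 !scale1r !cat_tsubstl.
  by rewrite tpureD scalerDr.
by rewrite tpureZ !scalerA mulrC.
Qed.

Lemma tcat_linear_l m n (y : tpow W n) : linear (fun x : tpow W m => tcat x y).
Proof. by apply: plift_linear; exact: tcat_rell. Qed.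

Lemma tcat_linear_r m n (x : tpow W m) : linear (fun y : tpow W n => tcat x y).
Proof.
move=> a y z; elim/fclassW: x => s; rewrite /tcat.
rewrite !plift_fclass; do ?exact: tcat_rell.
by apply: flift_lin => v; apply: plift_linear; exact: tcat_relr.
Qed.

Lemma tcat_pure m n (v : m.-tuple W) (w : n.-tuple W) :
  tcat (tpure v) (tpure w) = tpure (cat_tuple v w).
Proof.
rewrite /tcat plift_gen; last exact: tcat_rell.
by rewrite plift_gen //; exact: tcat_relr.
Qed.

Let tpow1_rel s t : @tpow_rel K W 1 s t ->
  flift (fun v : 1.-tuple W => thead v) s = flift (fun v => thead v) t.
Proof.
have E v i (x : W) : thead (@tsubst K W 1 v i x) = x.
  by rewrite /thead tnth_mktuple [ord0]ord1 [i]ord1.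
by case=> *; rewrite flift1 ?flift2 ?flift1 !scale1r !E.
Qed.

Lemma tpow1_linear : linear (@tpow1 K W).
Proof. by apply: plift_linear; exact: tpow1_rel. Qed.

Lemma tpow1_pure (v : 1.-tuple W) : tpow1 (tpure v) = thead v.
Proof. by rewrite /tpow1 plift_gen //; exact: tpow1_rel. Qed.

End TensorTheory.

Section DirectSum.
Variables (K : comPzRingType) (I : choiceType) (M : I -> lmodType K).

Record dsum := DSum {
  dsum_fun :> forall i, M i;
  _ : exists s : seq I, forall i, i \notin s -> dsum_fun i = 0 }.

HB.instance Definition _ := gen_eqMixin dsum.
HB.instance Definition _ := gen_choiceMixin dsum.

Lemma dsumP (x y : dsum) : (forall i, x i = y i) -> x = y.
Proof.
case: x y => [f pf] [g pg] /= fg; have {}fg : f = g by exact: functional_extensionality_dep.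
by rewrite fg in pf *; congr DSum; exact: Prop_irrelevance.
Qed.

Lemma dsum0_fin : exists s : seq I, forall i, i \notin s -> 0 = 0 :> M i.
Proof. by exists [::]. Qed.
Definition dsum0 := DSum dsum0_fin.

Lemma dsumD_fin (x y : dsum) :
  exists s : seq I, forall i, i \notin s -> x i + y i = 0.
Proof.
case: x y => [f [s fs]] [g [t gt]]; exists (s ++ t) => i.
by rewrite mem_cat negb_or => /andP[/fs /= -> /gt ->]; rewrite addr0.
Qed.
Definition dsumD x y := DSum (dsumD_fin x y).

Lemma dsumZ_fin a (x : dsum) :
  exists s : seq I, forall i, i \notin s -> a *: x i = 0.
Proof. by case: x => [f [s fs]]; exists s => i /fs /= ->; rewrite scaler0. Qed.
Definition dsumZ a x := DSum (dsumZ_fin a x).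

Lemma dsumDA : associative dsumD.
Proof. by move=> x y z; apply: dsumP => i /=; rewrite addrA. Qed.
Lemma dsumDC : commutative dsumD.
Proof. by move=> x y; apply: dsumP => i /=; rewrite addrC. Qed.
Lemma dsum0D : left_id dsum0 dsumD.
Proof. by move=> x; apply: dsumP => i /=; rewrite add0r. Qed.
Lemma dsumND : left_inverse dsum0 (dsumZ (-1)) dsumD.
Proof. by move=> x; apply: dsumP => i /=; rewrite scaleN1r addNr. Qed.

HB.instance Definition _ :=
  GRing.isZmodule.Build dsum dsumDA dsumDC dsum0D dsumND.

Lemma dsumZA a b x : dsumZ a (dsumZ b x) = dsumZ (a * b) x.
Proof. by apply: dsumP => i /=; rewrite scalerA. Qed.
Lemma dsum1Z : left_id 1 dsumZ.
Proof. by move=> x; apply: dsumP => i /=; rewrite scale1r. Qed.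
Lemma dsumZDr : right_distributive dsumZ +%R.
Proof. by move=> a x y; apply: dsumP => i /=; rewrite scalerDr. Qed.
Lemma dsumZDl x : {morph dsumZ^~ x : a b / a + b}.
Proof. by move=> a b; apply: dsumP => i /=; rewrite scalerDl. Qed.

HB.instance Definition _ :=
  GRing.Zmodule_isLmodule.Build K dsum dsumZA dsum1Z dsumZDr dsumZDl.

Definition single_fun i (x : M i) j : M j :=
  if i =P j is ReflectT e then ecast k (M k) e x else 0.

Lemma single_fin i (x : M i) :
  exists s : seq I, forall j, j \notin s -> single_fun x j = 0.
Proof.
exists [:: i] => j; rewrite inE /single_fun; case: eqP => // e /eqP ji.
by case: ji.
Qed.

Definition dsum_in i (x : M i) : dsum := DSum (single_fin x).

Lemma dsum_inE i (x : M i) : dsum_in x i = x.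
Proof.
rewrite /= /single_fun; case: eqP => // e.
by rewrite (Prop_irrelevance e erefl).
Qed.

Lemma dsum_in_linear i : linear (@dsum_in i).
Proof.
move=> a x y; apply: dsumP => j /=; rewrite /single_fun; case: eqP => [e|_].
  by case: _ / e.
by rewrite scaler0 addr0.
Qed.

End DirectSum.

Section HomModule.
Variables (K : comPzRingType) (U V : lmodType K).

Definition hom_pred : {pred U -> V} := fun f => `[< linear f >].

Lemma hom_pred_closed : GRing.submod_closed hom_pred.
Proof.
split=> [|a f g /asboolP lf /asboolP lg]; apply/asboolP.
  by move=> a x y; rewrite scaler0 addr0.
move=> b x y; rewrite -[LHS]/(a *: f _ + g _) lf lg.
rewrite -[RHS]/(b *: (a *: f x + g x) + (a *: f y + g y)).
by rewrite !scalerDr !scalerA [b * a]mulrC addrACA.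
Qed.
HB.instance Definition _ :=
  GRing.isSubmodClosed.Build K (U -> V) hom_pred hom_pred_closed.

Record hom := Hom { hom_fun :> U -> V; _ : hom_fun \in hom_pred }.
HB.instance Definition _ := [isSub for hom_fun].
HB.instance Definition _ := [Choice of hom by <:].
HB.instance Definition _ := [SubChoice_isSubLmodule of hom by <:].

Lemma hom_linear (f : hom) : linear f.
Proof. by case: f => f /= /asboolP. Qed.
HB.instance Definition _ (f : hom) :=
  GRing.isLinear.Build K U V _ f (hom_linear f).

Lemma homP (f g : hom) : f =1 g -> f = g.
Proof. by move=> fg; apply: val_inj; apply/funext. Qed.

End HomModule.

Inductive tree := Leaf | Node of tree & tree.

HB.instance Definition _ := gen_eqMixin tree.
HB.instance Definition _ := gen_choiceMixin tree.

Fixpoint nleaf t := if t is Node t u then (nleaf t + nleaf u)%N else 1%N.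

Variant side := L | R.

HB.instance Definition _ := gen_eqMixin side.
HB.instance Definition _ := gen_choiceMixin side.

(* The nodes of a tree are the words in L, R leading to them from the root. *)
Fixpoint leaves t : (nleaf t).-tuple (seq side) :=
  match t with
  | Leaf => [tuple [::]]
  | Node t u => cat_tuple (map_tuple (cons L) (leaves t))
                          (map_tuple (cons R) (leaves u))
  end.

Fixpoint inner t : seq (seq side) :=
  match t with
  | Leaf => [::]
  | Node t u => [::] :: map (cons L) (inner t) ++ map (cons R) (inner u)
  end.

Section TreeTensor.
Variables (K : comPzRingType) (W : lmodType K).

Definition ttensor_at t : lmodType K := tpow W (nleaf t).

Definition ttensor : lmodType K := dsum ttensor_at.

Definition tmul t u (x : ttensor_at t) (y : ttensor_at u) :
  ttensor_at (Node t u) := tcat x y.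

End TreeTensor.

(* The basis element of the tree-tensor algebra of K corresponding to t. *)
Definition tree_elt (K : comPzRingType) t : ttensor K^o :=
  dsum_in (tpure [tuple of nseq (nleaf t) (1 : K^o)] : ttensor_at K^o t).

(* A node with n.+1 left and n.+1 right children. Child indices start at 0,
   so (L, i) stands for the symbol L(i+1), and similarly for R. *)
CoInductive gentree (W : Type) : Type :=
  GNode : W -> forall n : nat,
    ('I_n.+1 -> gentree W) -> ('I_n.+1 -> gentree W) -> gentree W.

Section Generated.
Variables (K : comPzRingType) (W : lmodType K).
Implicit Types (s : gentree W) (t u : tree).

Definition position := seq (side * nat).

(* The label of s at a position, or None if there is no such node. *)
Fixpoint label s (r : position) : option W :=
  match s, r with
  | GNode w _ _ _, [::] => Some w
  | @GNode _ _ n cl cr, (x, i) :: r' =>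
      if (insub i : option 'I_n.+1) is Some j
      then label (if x is L then cl j else cr j) r' else None
  end.

(* The position sequence obtained from the word p when each letter of p, say
   p = q x q', receives the index i q. *)
Fixpoint posn (i : seq side -> nat) (p : seq side) : position :=
  if p is x :: p' then (x, i [::]) :: posn (fun q => i (x :: q)) p' else [::].

(* Assignments of an index to each inner node of t, extended by 0 to all
   words. *)
Definition assignment t := {ffun seq_sub (inner t) -> nat}.

Definition asg_at t (i : assignment t) (q : seq side) : nat :=
  if insub q is Some x then i x else 0%N.

Definition admissible s t : set (assignment t) :=
  [set i | all (fun p => label s (posn (asg_at i) p)) (leaves t)].
Arguments admissible : clear implicits.

Definition asg_tensor s t (i : assignment t) : ttensor_at W t :=
  tpure (map_tuple (fun p => odflt 0 (label s (posn (asg_at i) p))) (leaves t)).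

(* For t = Leaf there is exactly one assignment, and the value is the label of
   the root. *)
Definition gen_value s t : ttensor_at W t :=
  \sum_(i \in admissible s t) asg_tensor s i.

Definition generates s (f : hom (ttensor K^o) (ttensor W)) : Prop :=
  forall t, f (tree_elt K t) = dsum_in (gen_value s t).

Definition representative (f : hom (ttensor K^o) (ttensor W)) : Prop :=
  exists s, generates s f.

Definition asg_merge t u n (i : assignment t) (j : assignment u) :
    assignment (Node t u) :=
  [ffun x => match val x with
             | [::] => n
             | L :: q => asg_at i q
             | R :: q => asg_at j q
             end].

Lemma asg_at_out t (i : assignment t) q : q \notin inner t -> asg_at i q = 0%N.
Proof. by rewrite /asg_at => qt; rewrite insubN. Qed.

Lemma asg_at_in t (i : assignment t) (x : seq_sub (inner t)) :
  asg_at i (val x) = i x.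
Proof. by rewrite /asg_at valK. Qed.

Lemma cons_inj (x : side) : injective (cons x).
Proof. by move=> p q []. Qed.

Lemma mem_innerL t u q : (L :: q \in inner (Node t u)) = (q \in inner t).
Proof.
rewrite inE /= mem_cat (mem_map (@cons_inj L)); apply: orb_idr.
by case/mapP.
Qed.
Lemma mem_innerR t u q : (R :: q \in inner (Node t u)) = (q \in inner u).
Proof.
rewrite inE /= mem_cat (mem_map (@cons_inj R)); apply: orb_idl.
by case/mapP.
Qed.

Lemma asg_merge_root t u n (i : assignment t) (j : assignment u) :
  asg_at (asg_merge n i j) [::] = n.
Proof. by rewrite /asg_at insubT ffunE. Qed.
Lemma asg_merge_left t u n (i : assignment t) (j : assignment u) q :
  asg_at (asg_merge n i j) (L :: q) = asg_at i q.
Proof.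
have [qt|qt] := boolP (L :: q \in inner (Node t u)).
  by rewrite {1}/asg_at insubT ffunE.
by rewrite !asg_at_out // -(mem_innerL t u).
Qed.
Lemma asg_merge_right t u n (i : assignment t) (j : assignment u) q :
  asg_at (asg_merge n i j) (R :: q) = asg_at j q.
Proof.
have [qt|qt] := boolP (R :: q \in inner (Node t u)).
  by rewrite {1}/asg_at insubT ffunE.
by rewrite !asg_at_out // -(mem_innerR t u).
Qed.

Lemma asg_ext t (i j : assignment t) : asg_at i =1 asg_at j -> i = j.
Proof. by move=> ij; apply/ffunP => x; rewrite -!asg_at_in ij. Qed.

Lemma asg_split t u (k : assignment (Node t u)) : exists n i j,
  k = @asg_merge t u n i j.
Proof.
exists (asg_at k [::]), [ffun x => asg_at k (L :: val x)],
  [ffun x => asg_at k (R :: val x)].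
apply: asg_ext => -[|[] q].
- by rewrite asg_merge_root.
- rewrite asg_merge_left; have [qt|qt] := boolP (q \in inner t).
    by rewrite {2}/asg_at insubT ffunE.
  by rewrite !asg_at_out ?mem_innerL.
- rewrite asg_merge_right; have [qt|qt] := boolP (q \in inner u).
    by rewrite {2}/asg_at insubT ffunE.
  by rewrite !asg_at_out ?mem_innerR.
Qed.

Lemma eq_posn i j p : i =1 j -> posn i p = posn j p.
Proof.
elim: p i j => //= x p IH i j ij; rewrite ij; congr cons.
by apply: IH => q; rewrite ij.
Qed.

Lemma label_merge x w n cl cr t u (a : 'I_n.+1) (i : assignment t)
    (j : assignment u) p :
  label (GNode w cl cr) (posn (asg_at (asg_merge a i j)) (x :: p)) =
  if x is L then label (cl a) (posn (asg_at i) p)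
  else label (cr a) (posn (asg_at j) p).
Proof.
rewrite /= asg_merge_root valK; case: x; congr label; apply: eq_posn => q.
  exact: asg_merge_left.
exact: asg_merge_right.
Qed.

Lemma admissible_merge w n cl cr t u (a : 'I_n.+1) (i : assignment t)
    (j : assignment u) :
  admissible (GNode w cl cr) (Node t u) (asg_merge a i j) <->
  admissible (cl a) t i /\ admissible (cr a) u j.
Proof.
have E x (v : seq (seq side)) :
    all (fun p => label (GNode w cl cr) (posn (asg_at (asg_merge a i j)) p))
      (map (cons x) v) =
    all (fun p => if x is L then label (cl a) (posn (asg_at i) p)
                  else label (cr a) (posn (asg_at j) p)) v.
  by rewrite all_map; apply: eq_all => p; rewrite -[LHS]/(isSome _)
    label_merge; case: x.
rewrite -[admissible (GNode w cl cr) _ _]/(is_true (all _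
  (map (cons L) (leaves t) ++ map (cons R) (leaves u)))) all_cat !E.
by split=> [/andP[]|[-> ->]].
Qed.

Lemma leaves_neq0 t : exists p, p \in (leaves t : seq _).
Proof.
elim: t => [|t [p pt] u _]; first by exists [::]; rewrite inE.
by exists (L :: p); rewrite mem_cat map_f.
Qed.

Lemma admissible_root w n cl cr t u (k : assignment (Node t u)) :
  admissible (@GNode W w n cl cr) (Node t u) k -> (asg_at k [::] < n.+1)%N.
Proof.
have [p pt] := leaves_neq0 t.
rewrite /admissible /= all_cat => /andP[/allP/(_ (L :: p))].
rewrite map_f // => /(_ isT) /=; case: insubP => //.
Qed.

Fixpoint asg_enum s t : seq (assignment t) :=
  match t with
  | Leaf => [:: [ffun=> 0%N]]
  | Node t1 t2 => let: GNode _ n cl cr := s in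
      [seq asg_merge a ij.1 ij.2 | a : 'I_n.+1 <- enum 'I_n.+1,
         ij <- [seq (i, j) | i <- asg_enum (cl a) t1, j <- asg_enum (cr a) t2]]
  end.

Lemma mem_asg_enum s t : [set` asg_enum s t]%classic = admissible s t.
Proof.
apply/seteqP; split.
  elim: t s => [|t IHt u IHu] [w n cl cr] k /=; first by [].
  case/allpairsPdep => a [[i j] [_ /allpairsP[[i' j'] /= [i't j'u [-> ->]]] ->]].
  by apply/admissible_merge; split; [exact: IHt|exact: IHu].
elim: t s => [|t IHt u IHu] [w n cl cr] k /=.
  move=> _; rewrite inE; apply/eqP/ffunP => x.
  by have := valP x; rewrite in_nil.
have [b [i [j ->]]] := asg_split k => adm.
have := admissible_root adm; rewrite asg_merge_root => bn.
rewrite -[b]/(val (Ordinal bn)) in adm *.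
case/admissible_merge: adm => it ju.
apply/allpairsPdep; exists (Ordinal bn), (i, j); split; rewrite ?mem_enum //.
by apply/allpairsP; exists (i, j); split; [exact: IHt|exact: IHu|].
Qed.

Lemma asg_merge_inj t u m n (i i' : assignment t) (j j' : assignment u) :
  asg_merge m i j = asg_merge n i' j' -> [/\ m = n, i = i' & j = j'].
Proof.
move=> e; split.
- by have := congr1 (fun k => asg_at k [::]) e; rewrite !asg_merge_root.
- apply: asg_ext => q; have := congr1 (fun k => asg_at k (L :: q)) e.
  by rewrite !asg_merge_left.
- apply: asg_ext => q; have := congr1 (fun k => asg_at k (R :: q)) e.
  by rewrite !asg_merge_right.
Qed.

Lemma asg_enum_uniq s t : uniq (asg_enum s t).
Proof.
elim: t s => [|t IHt u IHu] [w n cl cr] //=.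
apply: allpairs_uniq_dep; first exact: enum_uniq.
  by move=> a _; apply: allpairs_uniq => // -[? ?] [? ?].
move=> [a [i j]] [a' [i' j']] _ _ /= /asg_merge_inj[aa -> ->].
by rewrite (val_inj aa).
Qed.

Lemma gen_valueE s t : gen_value s t = \sum_(i <- asg_enum s t) asg_tensor s i.
Proof. by rewrite fsbig_seq ?asg_enum_uniq // mem_asg_enum. Qed.

Lemma gen_value_leaf w n cl cr :
  gen_value (@GNode W w n cl cr) Leaf = tpure [tuple w].
Proof.
by rewrite gen_valueE big_seq1; congr tpure; apply: val_inj.
Qed.

Lemma asg_tensor_merge w n cl cr t u (a : 'I_n.+1) (i : assignment t)
    (j : assignment u) :
  asg_tensor (GNode w cl cr) (asg_merge a i j) =
  tmul (asg_tensor (cl a) i) (asg_tensor (cr a) j).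
Proof.
rewrite /tmul tcat_pure; congr tpure; apply: val_inj.
rewrite /= map_cat -!map_comp; congr cat; apply: eq_map => p.
  by rewrite -[RHS](congr1 (odflt 0) (label_merge L w cl cr a i j p)).
by rewrite -[RHS](congr1 (odflt 0) (label_merge R w cl cr a i j p)).
Qed.

Lemma tmul_suml t u (I : Type) (r : seq I) (F : I -> ttensor_at W t)
    (y : ttensor_at W u) :
  tmul (\sum_(i <- r) F i) y = \sum_(i <- r) tmul (F i) y.
Proof.
pose h := HB.pack_for {linear ttensor_at W t -> ttensor_at W (Node t u)}
  (fun x => tmul x y) (GRing.isLinear.Build _ _ _ _ _ (tcat_linear_l y)).
exact: (linear_sum h).
Qed.
Lemma tmul_sumr t u (I : Type) (r : seq I) (x : ttensor_at W t)
    (F : I -> ttensor_at W u) :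
  tmul x (\sum_(i <- r) F i) = \sum_(i <- r) tmul x (F i).
Proof.
pose h := HB.pack_for {linear ttensor_at W u -> ttensor_at W (Node t u)}
  (fun y => tmul x y) (GRing.isLinear.Build _ _ _ _ _ (tcat_linear_r x)).
exact: (linear_sum h).
Qed.
Lemma tmul0l t u (y : ttensor_at W u) : tmul (0 : ttensor_at W t) y = 0.
Proof.
by have := tmul_suml [::] (fun _ : nat => 0 : ttensor_at W t) y; rewrite !big_nil.
Qed.
Lemma tmulZl t u a (x : ttensor_at W t) (y : ttensor_at W u) :
  tmul (a *: x) y = a *: tmul x y.
Proof. by have := tcat_linear_l y a x 0; rewrite -/(tmul _ _) !addr0 [tcat 0 y]tmul0l addr0. Qed.

Lemma gen_value_node w n cl cr t u :
  gen_value (GNode w cl cr) (Node t u) =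
  \sum_(a < n.+1) tmul (gen_value (cl a) t) (gen_value (cr a) u).
Proof.
rewrite gen_valueE /= big_allpairs_dep big_enum /=; apply: eq_bigr => a _.
rewrite big_allpairs_dep !gen_valueE tmul_suml; apply: eq_bigr => i _ /=.
by rewrite tmul_sumr; apply: eq_bigr => j _; exact: asg_tensor_merge.
Qed.

End Generated.

Section RepSubmodule.
Variables (K : comPzRingType) (W : lmodType K).

Definition gadd (s s' : gentree W) : gentree W :=
  match s, s' with
  | @GNode _ w n cl cr, @GNode _ w' n' cl' cr' =>
    @GNode W (w + w') (n + n'.+1)
      (fun i : 'I_(n.+1 + n'.+1) => match fintype.split i with
                                    | inl j => cl j | inr j => cl' j end)
      (fun i : 'I_(n.+1 + n'.+1) => match fintype.split i with
                                    | inl j => cr j | inr j => cr' j end)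
  end.

CoFixpoint gscale (a : K) (s : gentree W) : gentree W :=
  let: @GNode _ w n cl cr := s in
  GNode (a *: w) (fun i => gscale a (cl i)) cr.

CoFixpoint gzero : gentree W := @GNode W 0 0 (fun=> gzero) (fun=> gzero).

Lemma gentree_eta (s : gentree W) :
  s = let: @GNode _ w n cl cr := s in GNode w cl cr.
Proof. by case: s. Qed.

Lemma tuple1_subst (w x : W) : [tuple x] = tsubst [tuple w] ord0 x.
Proof.
by apply: eq_from_tnth => i; rewrite tnth_mktuple [i]ord1 (tnth_nth 0).
Qed.

Lemma tpure1D (x y : W) :
  tpure [tuple x + y] = tpure [tuple x] + tpure [tuple y].
Proof.
rewrite (tuple1_subst 0 (x + y)) tpureD.
by rewrite -(tuple1_subst 0 x) -(tuple1_subst 0 y).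
Qed.
Lemma tpure1Z a (x : W) : tpure [tuple a *: x] = a *: tpure [tuple x].
Proof. by rewrite (tuple1_subst 0 (a *: x)) tpureZ -(tuple1_subst 0 x). Qed.

Lemma gen_value_add s s' t :
  gen_value (gadd s s') t = gen_value s t + gen_value s' t.
Proof.
case: s s' => [w n cl cr] [w' n' cl' cr']; case: t => [|t u].
  by rewrite /= !gen_value_leaf tpure1D.
rewrite /= !gen_value_node; rewrite (@big_split_ord _ _ _ n.+1 n'.+1).
congr (_ + _); apply: eq_bigr => i _.
  by rewrite (unsplitK (inl i)).
by rewrite (unsplitK (inr i)).
Qed.

Lemma gen_value_scale a s t : gen_value (gscale a s) t = a *: gen_value s t.
Proof.
elim: t s => [|t IHt u _] [w n cl cr]; rewrite [gscale _ _]gentree_eta /=.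
  by rewrite !gen_value_leaf tpure1Z.
rewrite !gen_value_node scaler_sumr; apply: eq_bigr => i _.
by rewrite IHt tmulZl.
Qed.

Lemma gen_value_zero t : gen_value gzero t = 0.
Proof.
elim: t => [|t IHt u _]; rewrite [gzero]gentree_eta /=.
  by rewrite gen_value_leaf -(scale0r (0 : W)) tpure1Z scale0r.
by rewrite gen_value_node big1 // => i _; rewrite IHt tmul0l.
Qed.

Definition rep_pred : {pred hom (ttensor K^o) (ttensor W)} :=
  fun f => `[< representative f >].

Lemma rep_pred_closed : GRing.submod_closed rep_pred.
Proof.
split=> [|a f g /asboolP[s fs] /asboolP[s' gs']]; apply/asboolP.
  exists gzero => t; rewrite gen_value_zero; apply: dsumP => u /=.
  by rewrite /single_fun; case: eqP => // e; case: _ / e.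
exists (gadd (gscale a s) s') => t.
rewrite gen_value_add gen_value_scale dsum_in_linear -fs -gs'.
by [].
Qed.
HB.instance Definition _ :=
  GRing.isSubmodClosed.Build K _ rep_pred rep_pred_closed.

(* The canonical isomorphism from a tensor power of K to K. *)
Definition unit_coef n (x : tpow K^o n) : K :=
  plift (fun v : n.-tuple K^o => \prod_(i < n) tnth v i : K^o) x.

Let unit_coef_rel n p q : @tpow_rel K K^o n p q ->
  flift (fun v : n.-tuple K^o => \prod_(i < n) tnth v i : K^o) p =
  flift (fun v : n.-tuple K^o => \prod_(i < n) tnth v i : K^o) q.
Proof.
have E v i x : \prod_(j < n) tnth (@tsubst K K^o n v i x) j =
    (x : K) * \prod_(j < n | j != i) tnth v j.
  rewrite (bigD1 i) //= tnth_mktuple eqxx; congr (_ * _).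
  by apply: eq_bigr => j /negPf ji; rewrite tnth_mktuple ji.
case=> [v i x y|v i a x]; rewrite flift1 ?flift2 ?flift1 !scale1r !E /=.
  by rewrite mulrDl.
by rewrite -[a *: x]/(a * x) -mulrA.
Qed.

Lemma unit_coef_linear n a (x y : tpow K^o n) :
  unit_coef (a *: x + y) = a * unit_coef x + unit_coef y.
Proof. by rewrite /unit_coef plift_linear //; exact: unit_coef_rel. Qed.

Lemma unit_coef1 n : unit_coef (tpure [tuple of nseq n (1 : K^o)]) = 1.
Proof.
rewrite /unit_coef plift_gen; last exact: unit_coef_rel.
by apply: big1 => i _; rewrite (tnth_nth 0) nth_nseq ltn_ord.
Qed.

Lemma gen_hom_fin (s : gentree W) (x : ttensor K^o) :
  exists r : seq tree, forall t, t \notin r ->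
    unit_coef (x t) *: gen_value s t = 0.
Proof.
have E t : unit_coef (0 : ttensor_at K^o t) = 0.
  have := unit_coef_linear 0 (0 : ttensor_at K^o t) 0.
  rewrite scale0r addr0 mul0r add0r => _.
  by have := @unit_coef_linear (nleaf t) (-1) 0 0;
     rewrite scaler0 addr0 mulN1r addNr.
by case: x => f [r fr]; exists r => t /fr /= ->; rewrite E scale0r.
Qed.

Definition gen_fun (s : gentree W) (x : ttensor K^o) : ttensor W :=
  DSum (gen_hom_fin s x).

Lemma gen_fun_linear s : gen_fun s \in @hom_pred K (ttensor K^o) (ttensor W).
Proof.
apply/asboolP => a x y; apply: dsumP => t.
rewrite -[LHS]/(unit_coef (a *: x t + y t) *: _) unit_coef_linear.
by rewrite scalerDl -scalerA.
Qed.

Definition gen_hom s := Hom (gen_fun_linear s).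

Lemma gen_homP s : generates s (gen_hom s).
Proof.
move=> t; apply: dsumP => u; rewrite -[LHS]/(unit_coef (tree_elt K t u) *: _).
rewrite /= /single_fun; case: eqP => [e|_].
  by case: _ / e; rewrite unit_coef1 scale1r.
have := unit_coef_linear 0 (0 : ttensor_at K^o u) 0.
have := @unit_coef_linear (nleaf u) (-1) 0 0.
by rewrite scaler0 addr0 mulN1r addNr => -> _; rewrite scale0r.
Qed.

Lemma gen_hom_rep s : gen_hom s \in rep_pred.
Proof. by apply/asboolP; exists s; exact: gen_homP. Qed.

End RepSubmodule.

Section RepModule.
Variables (K : comPzRingType) (V : lmodType K).

Definition oplusK : lmodType K := (V * K^o)%type.

Record rep := MkRep {
  rep_hom :> hom (ttensor K^o) (ttensor oplusK);
  _ : rep_hom \in @rep_pred K oplusK }.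
HB.instance Definition _ := [isSub for rep_hom].
HB.instance Definition _ := [Choice of rep by <:].
HB.instance Definition _ := [SubChoice_isSubLmodule of rep by <:].

(* f(t) lies in the summand at t since f is tree-graded; its other components
   are 0. *)
Definition rep_val (f : rep) t : ttensor_at oplusK t :=
  f (tree_elt K t) t.

Lemma rep_val_linear t : linear (fun f => rep_val f t).
Proof. by []. Qed.

Definition rep_of (s : gentree oplusK) : rep := MkRep (gen_hom_rep s).

Lemma rep_valE (f : rep) s : generates s f ->
  forall t, rep_val f t = gen_value s t.
Proof. by move=> fs t; rewrite /rep_val fs dsum_inE. Qed.

Lemma rep_of_val s t : rep_val (rep_of s) t = gen_value s t.
Proof. by apply: rep_valE; exact: gen_homP. Qed.

Lemma rep_gen (f : rep) : exists s, generates s f.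
Proof. by case: f => f /= /asboolP. Qed.

(* The finite families (g_i) and (h_i) are given as one list of pairs. *)
Definition decomposes (f : rep) (gh : seq (rep * rep)) : Prop :=
  forall t u, rep_val f (Node t u) =
    \sum_(p <- gh) tmul (rep_val p.1 t) (rep_val p.2 u).

Definition family_tensor (gh : seq (rep * rep)) : tensor rep rep :=
  \sum_(p <- gh) tens p.1 p.2.

Lemma decomposes_ex (f : rep) : exists gh, decomposes f gh.
Proof.
have [[w n cl cr] fs] := rep_gen f.
exists [seq (rep_of (cl i), rep_of (cr i)) | i <- enum 'I_n.+1] => t u.
rewrite (rep_valE fs) gen_value_node big_map big_enum /=.
by apply: eq_bigr => i _; rewrite !rep_of_val.
Qed.

(* The comultiplication, for a choice of the families. It is a homomorphism
   when the result does not depend on that choice. *)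
Definition comul_fun (f : rep) : tensor rep rep :=
  family_tensor (xget [::] [set gh | decomposes f gh]%classic).

(* Independence of the choice of the families, i.e. injectivity of the map from
   rep (x) rep to the product of the modules indexed by pairs of grading trees.
   This holds over a field, but not for all K and V: for K the integers and
   V = Q/Z, let x be the homomorphism with
     x(t) = 1 (x) ... (x) 1 (x) 1/d!
   where d is the depth of the last leaf of t. Then x(t) (x) x(u) = 0 for all
   t and u, but x (x) x is not 0. *)
Definition comul_independent : Prop :=
  forall (f : rep) (gh gh' : seq (rep * rep)),
    decomposes f gh -> decomposes f gh' ->
    family_tensor gh = family_tensor gh'.

Lemma comul_funE : comul_independent ->
  forall f gh, decomposes f gh -> comul_fun f = family_tensor gh.
Proof.
move=> ind f gh fgh; rewrite /comul_fun; apply: (ind f) => //.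
by case: xgetP => [_ _ //|/(_ gh)].
Qed.

Lemma decomposes_lin a f g gh gh' : decomposes f gh -> decomposes g gh' ->
  decomposes (a *: f + g) ([seq (a *: p.1, p.2) | p <- gh] ++ gh').
Proof.
move=> fgh ggh' t u; rewrite rep_val_linear fgh ggh' big_cat big_map /=.
congr (_ + _); rewrite scaler_sumr; apply: eq_bigr => p _.
by rewrite -tmulZl; congr tmul; have := rep_val_linear t a p.1 0;
   rewrite addr0 => ->; rewrite [rep_val 0 t](_ : _ = 0) ?addr0.
Qed.

Lemma comul_linear : comul_independent -> linear comul_fun.
Proof.
move=> ind a f g; have [gh fgh] := decomposes_ex f.
have [gh' ggh'] := decomposes_ex g.
rewrite (comul_funE ind (decomposes_lin a fgh ggh')).
rewrite (comul_funE ind fgh) (comul_funE ind ggh').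
rewrite /family_tensor big_cat big_map scaler_sumr; congr (_ + _).
by apply: eq_bigr => p _; rewrite tensZl.
Qed.

Definition rep_root (f : rep) : oplusK := tpow1 (rep_val f Leaf).

Definition rep_counit_fun (f : rep) : K^o := (rep_root f).2.
Definition rep_proj_fun (f : rep) : V := (rep_root f).1.

Lemma rep_root_linear : linear rep_root.
Proof. by move=> a f g; rewrite /rep_root rep_val_linear tpow1_linear. Qed.
Lemma rep_counit_linear : linear rep_counit_fun.
Proof. by move=> a f g; rewrite /rep_counit_fun rep_root_linear. Qed.
Lemma rep_proj_linear : linear rep_proj_fun.
Proof. by move=> a f g; rewrite /rep_proj_fun rep_root_linear. Qed.

HB.instance Definition _ :=
  GRing.isLinear.Build K rep K^o _ rep_counit_fun rep_counit_linear.
HB.instance Definition _ :=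
  GRing.isLinear.Build K rep V _ rep_proj_fun rep_proj_linear.

End RepModule.

Record precoalgebra (K : comPzRingType) := Precoalgebra {
  pc_mod :> lmodType K;
  pc_comul : {linear pc_mod -> tensor pc_mod pc_mod};
  pc_counit : {linear pc_mod -> K^o} }.

Definition precoalgebra_morphism (K : comPzRingType) (D C : precoalgebra K)
    (phi : {linear D -> C}) : Prop :=
  (forall d, pc_comul C (phi d) = tensor_map phi phi (pc_comul D d)) /\
  (forall d, pc_counit C (phi d) = pc_counit D d).

Definition cofree_over (K : comPzRingType) (V : lmodType K)
    (C : precoalgebra K) (pi : {linear C -> V}) : Prop :=
  forall (D : precoalgebra K) (phi : {linear D -> V}),
  exists phit : {linear D -> C},
    [/\ precoalgebra_morphism phit,
        forall d, pi (phit d) = phi d &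
        forall psi : {linear D -> C}, precoalgebra_morphism psi ->
          (forall d, pi (psi d) = phi d) -> forall d, psi d = phit d].

Section RepPrecoalgebra.
Variables (K : comPzRingType) (V : lmodType K).

Definition rep_counit : {linear rep V -> K^o} := @rep_counit_fun K V.
Definition rep_proj : {linear rep V -> V} := @rep_proj_fun K V.

Hypothesis ind : comul_independent V.

Definition rep_comul : {linear rep V -> tensor (rep V) (rep V)} :=
  HB.pack_for {linear rep V -> tensor (rep V) (rep V)} (@comul_fun K V)
    (GRing.isLinear.Build K (rep V) (tensor (rep V) (rep V)) _ (@comul_fun K V)
      (comul_linear ind)).

Definition rep_precoalgebra : precoalgebra K :=
  Precoalgebra rep_comul rep_counit.

End RepPrecoalgebra.

(* Main.v *)
Require Import Defs.
From HB Require Import structures.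
From mathcomp Require Import all_boot all_algebra.

(** Why the theorem holds.

    Existence. Iterating the comultiplication of [D] along a grading tree [t]
    and applying [(phi, eps)] at each leaf gives a linear map
    [D -> (V + K)^(leaf t)]. For a fixed [d] these values, taken over all [t],
    are generated by one tree: label the root with [(phi d, eps d)], write the
    coproduct of [d] as a finite sum of pure tensors [g_i (x) h_i], and take as
    subtrees at [L(i)] and [R(i)] the trees built in the same way from [g_i]
    and [h_i] ([comul_tree]). The tree depends on the chosen pure tensors, but
    its values do not: the value at [Node t u] is the image of the coproduct of
    [d] under the linear map induced by the bilinear product of the values at
    [t] and [u], so that induction on [t] also proves the values linear in [d]
    ([comul_tree_value_linear]). Since a representative homomorphism is
    determined by its values ([rep_ext]), this is a linear map into [rep V],
    and the images of the [g_i] and [h_i] decompose the image of [d]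
    ([comul_tree_decomposes]). Since the coproduct does not depend on the
    decomposition, it is the sum of the tensors of these images, which is what
    it means to be a morphism.

    Uniqueness. The value of a representative homomorphism at [Leaf] is known
    from its counit and projection, and its value at [Node t u] from its
    coproduct and the values at [t] and [u] ([rep_val_node]). Hence two
    morphisms that agree after projection to [V] agree at every grading tree,
    by induction on the tree ([morphism_val_unique]). *)

Set Implicit Arguments.
Unset Strict Implicit.
Unset Printing Implicit Defensive.

Import GRing.Theory.
Local Open Scope ring_scope.

(** * Tensors as finite sums of pure tensors *)

Definition linear_of (K : comPzRingType) (U V : lmodType K) (f : U -> V)
    (lf : linear f) : {linear U -> V} :=
  HB.pack_for {linear U -> V} f (GRing.isLinear.Build _ _ _ _ f lf).

Section TensorLift.
Variables (K : comPzRingType) (M N : lmodType K).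

(** The leading zero pair makes the list nonempty, because a node of a
    generating tree has at least one child on each side. *)
Definition summands (z : tensor M N) : seq (M * N) :=
  (0, 0) :: [seq (p.1 *: p.2.1, p.2.2) | p <- repr z].

Lemma tens00 : tens (0 : M) (0 : N) = 0.
Proof. by rewrite -[0 : M](scale0r 0) tensZl scale0r. Qed.

Lemma summandsE (z : tensor M N) : z = \sum_(p <- summands z) tens p.1 p.2.
Proof.
rewrite big_cons big_map tens00 add0r -{1}[z]reprK.
rewrite -[LHS]/(fclass _ _) fclassE; apply: eq_bigr => -[a [m n]] _ /=.
by rewrite tensZl.
Qed.

Variables (P : lmodType K) (f : M -> N -> P).
Hypothesis f_linl : forall n, linear (f^~ n).
Hypothesis f_linr : forall m, linear (f m).

Definition tensor_lift (z : tensor M N) : P :=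
  plift (fun p : M * N => f p.1 p.2) z.

Lemma tensor_lift_rel s t : @tensor_rel K M N s t ->
  flift (fun p : M * N => f p.1 p.2) s = flift (fun p : M * N => f p.1 p.2) t.
Proof.
case=> [m m' n|m n n'|a m n|a m n]; rewrite flift1 ?flift2 ?flift1 !scale1r /=.
- exact: (linearD (linear_of (f_linl n))).
- exact: (linearD (linear_of (f_linr m))).
- exact: (linearZ_LR (linear_of (f_linl n))).
- exact: (linearZ_LR (linear_of (f_linr m))).
Qed.

Lemma tensor_lift_linear : linear tensor_lift.
Proof. exact/plift_linear/tensor_lift_rel. Qed.

Lemma tensor_lift_tens m n : tensor_lift (tens m n) = f m n.
Proof. by rewrite /tensor_lift plift_gen //; exact: tensor_lift_rel. Qed.

Lemma tensor_lift_sum (r : seq (M * N)) :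
  tensor_lift (\sum_(p <- r) tens p.1 p.2) = \sum_(p <- r) f p.1 p.2.
Proof.
rewrite [LHS](linear_sum (linear_of tensor_lift_linear)).
by apply: eq_bigr => p _; exact: tensor_lift_tens.
Qed.

End TensorLift.

Lemma tensor_map_sum (K : comPzRingType) (M N M' N' : lmodType K)
    (f : {linear M -> M'}) (g : {linear N -> N'}) (r : seq (M * N)) :
  tensor_map f g (\sum_(p <- r) tens p.1 p.2)
  = \sum_(p <- r) tens (f p.1) (g p.2).
Proof.
rewrite [LHS](linear_sum (linear_of (tensor_map_linear f g))).
by apply: eq_bigr => p _; exact: tensor_map_tens.
Qed.

(** * Tensor powers and direct sums *)

Lemma tpow1K (K : comPzRingType) (W : lmodType K) (x : tpow W 1) :
  tpure [tuple tpow1 x] = x.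
Proof.
apply: (@pres_ext _ _ _ _ (fun x : tpow W 1 => tpure [tuple tpow1 x]) id) => //.
  by move=> a y z; rewrite tpow1_linear tpure1D tpure1Z.
move=> v; rewrite -[pgen _ _]/(tpure v) tpow1_pure; congr tpure.
by apply: eq_from_tnth => i; rewrite [i]ord1 (tnth_nth 0).
Qed.

Lemma tpow1_inj (K : comPzRingType) (W : lmodType K) :
  injective (@tpow1 K W).
Proof. by move=> x y xy; rewrite -[x]tpow1K xy tpow1K. Qed.

(** Pulling the entries of a pure tensor out as scalars, one at a time from the
    left, leaves the tensor whose entries are all 1. *)
Lemma tpure_unit (K : comPzRingType) n (v : n.-tuple K^o) :
  exists c : K, tpure v = c *: tpure [tuple of nseq n (1 : K^o)].
Proof.
elim: n v => [|n IH] v.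
  by exists 1; rewrite scale1r; congr tpure; apply: val_inj; rewrite /= tuple0.
case/tupleP: v => x v; have [c vc] := IH v.
have consE (y : K^o) (w : n.-tuple K^o) :
    tpure [tuple of y :: w] = @tcat K K^o 1 n (tpure [tuple y]) (tpure w).
  by rewrite tcat_pure; congr tpure; exact: val_inj.
have xE : tpure [tuple x] = (x : K) *: tpure [tuple (1 : K^o)].
  by rewrite -tpure1Z; congr tpure; apply: val_inj; rewrite /= -[x in LHS]mulr1.
exists (c * x); rewrite consE vc xE.
rewrite [LHS](linearZ_LR (linear_of (tcat_linear_r _))) /=.
rewrite [tcat _ _](linearZ_LR (linear_of (tcat_linear_l _))) /=.
rewrite scalerA -consE.
by congr (_ *: tpure _); exact: val_inj.
Qed.

Lemma tpow_unit (K : comPzRingType) n (x : tpow K^o n) :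
  exists c : K, x = c *: tpure [tuple of nseq n (1 : K^o)].
Proof.
elim/fclassW: x => s; rewrite fclassE.
elim: s => [|[a v] s [c IH]]; first by exists 0; rewrite big_nil scale0r.
have [b vb] := tpure_unit v; exists (a * b + c).
by rewrite big_cons IH -[pgen _ _]/(tpure v) vb scalerDl scalerA.
Qed.

Lemma dsum_sumE (K : comPzRingType) (I : choiceType) (M : I -> lmodType K)
    (T : Type) (r : seq T) (F : T -> dsum M) i :
  (\sum_(k <- r) F k) i = \sum_(k <- r) F k i.
Proof.
by elim: r => [|k r IH]; rewrite ?big_nil // !big_cons -IH.
Qed.

Lemma dsum_decomp (K : comPzRingType) (I : choiceType) (M : I -> lmodType K)
    (x : dsum M) : exists s : seq I, x = \sum_(i <- s) dsum_in (x i).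
Proof.
have [s xs] : exists s : seq I, forall i, i \notin s -> x i = 0 by case: x.
exists (undup s); apply: dsumP => i; rewrite dsum_sumE.
have in_neq j : j != i -> dsum_in (x j) i = 0.
  by rewrite /= /single_fun; case: eqP.
have [si|si] := boolP (i \in s); last first.
  rewrite xs // big1_seq // => j /=; rewrite mem_undup => sj.
  by apply: in_neq; apply: contraNneq si => <-.
rewrite (bigD1_seq i) ?mem_undup ?undup_uniq // [dsum_in _ _]dsum_inE.
by rewrite (big1 _ _ _ in_neq) /= addr0.
Qed.

(** * Values of representative homomorphisms *)

(** The elements [tree_elt K t] span the tree-tensor algebra of [K]. *)
Lemma hom_tree_ext (K : comPzRingType) (P : lmodType K)
    (f g : Defs.hom (ttensor K^o) P) :
  (forall t, f (tree_elt K t) = g (tree_elt K t)) -> f = g.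
Proof.
move=> fg; apply: homP => x; have [s ->] := dsum_decomp x.
rewrite !linear_sum; apply: eq_bigr => t _.
have [c ->] := tpow_unit (x t).
rewrite [dsum_in _](linearZ_LR (linear_of (@dsum_in_linear _ _ _ t))) /=.
rewrite !linearZ /=.
by congr (_ *: _); exact: fg.
Qed.

Section RepValues.
Variables (K : comPzRingType) (V : lmodType K).
Implicit Types (f g : rep V) (t u : tree).

(** The other components of [f (tree_elt K t)] vanish, as [f] is tree-graded. *)
Lemma rep_ext f g : (forall t, rep_val f t = rep_val g t) -> f = g.
Proof.
move=> fg; apply: val_inj; apply: hom_tree_ext => t /=.
have [s fs] := rep_gen f; have [s' gs'] := rep_gen g.
by rewrite fs gs' -(rep_valE fs) -(rep_valE gs') fg.
Qed.

Lemma tmul_val_linl (A : lmodType K) t u (F : A -> ttensor_at (oplusK V) t)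
    (y : ttensor_at (oplusK V) u) :
  linear F -> linear (fun x => tmul (F x) y).
Proof. by move=> lF a x x'; rewrite lF; exact: tcat_linear_l. Qed.

Lemma tmul_val_linr (A : lmodType K) t u (x : ttensor_at (oplusK V) t)
    (F : A -> ttensor_at (oplusK V) u) :
  linear F -> linear (fun y => tmul x (F y)).
Proof. by move=> lF a y y'; rewrite lF; exact: tcat_linear_r. Qed.

(** Any way of writing the coproduct as a sum of pure tensors computes the
    values at composite trees, since the map that evaluates the two factors and
    multiplies the results is defined on the tensor product itself. *)
Lemma rep_val_node (ind : comul_independent V) f (gh : seq (rep V * rep V))
    t u : comul_fun f = family_tensor gh ->
  rep_val f (Node t u) = \sum_(p <- gh) tmul (rep_val p.1 t) (rep_val p.2 u).
Proof.
have [gh' fgh'] := decomposes_ex f; rewrite (comul_funE ind fgh') fgh' => E.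
pose F (g h : rep V) := tmul (rep_val g t) (rep_val h u).
have Fl h : linear (F^~ h) by apply: tmul_val_linl; exact: rep_val_linear.
have Fr g : linear (F g) by apply: tmul_val_linr; exact: rep_val_linear.
by rewrite -!(tensor_lift_sum Fl Fr); congr tensor_lift.
Qed.

End RepValues.

(** * The induced morphism *)

Section Cofree.
Variables (K : comPzRingType) (V : lmodType K) (ind : comul_independent V).
Variables (D : precoalgebra K) (phi : {linear D -> V}).
Implicit Types (d : D) (t u : tree).

Definition comul_summands d : seq (D * D) := summands (pc_comul D d).

(** The root gets as many pairs of children as there are summands; the index
    type ['I_(size (comul_summands d)).-1.+1] has that size by conversion,
    since the list of summands is a cons. *)
CoFixpoint comul_tree d : gentree (oplusK V) :=
  @GNode (oplusK V) (phi d, pc_counit D d) (size (comul_summands d)).-1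
    (fun i => comul_tree (nth (0, 0) (comul_summands d) i).1)
    (fun i => comul_tree (nth (0, 0) (comul_summands d) i).2).

Lemma comul_tree_leaf d :
  gen_value (comul_tree d) Leaf = tpure [tuple (phi d, pc_counit D d)].
Proof. by rewrite [comul_tree d]gentree_eta /= gen_value_leaf. Qed.

Lemma comul_tree_node d t u :
  gen_value (comul_tree d) (Node t u) =
  \sum_(p <- comul_summands d)
    tmul (gen_value (comul_tree p.1) t) (gen_value (comul_tree p.2) u).
Proof.
rewrite [comul_tree d]gentree_eta /= gen_value_node.
by rewrite [RHS](big_nth (0, 0)) big_mkord.
Qed.

(** The summands of a coproduct are not linear in [d], but the value depends on
    them only through their sum. *)
Lemma comul_tree_value_linear t :
  linear (fun d => gen_value (comul_tree d) t).
Proof.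
elim: t => [|t IHt u IHu] a d d'.
  by rewrite !comul_tree_leaf -tpure1Z -tpure1D !linearD !linearZ.
pose F x y := tmul (gen_value (comul_tree x) t) (gen_value (comul_tree y) u).
have Fl y : linear (F^~ y) by exact: tmul_val_linl.
have Fr x : linear (F x) by exact: tmul_val_linr.
have E x : gen_value (comul_tree x) (Node t u) = tensor_lift F (pc_comul D x).
  by rewrite comul_tree_node [pc_comul D x]summandsE tensor_lift_sum.
by rewrite !E linearP tensor_lift_linear.
Qed.

Definition cofree_fun d : rep V := rep_of (comul_tree d).

Lemma cofree_linear : linear cofree_fun.
Proof.
move=> a d d'; apply: rep_ext => t.
by rewrite rep_val_linear !rep_of_val comul_tree_value_linear.
Qed.

Definition cofree_lift : {linear D -> rep V} := linear_of cofree_linear.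

(** The recursion of the generated values at [Node t u] over the children of the
    root is the defining equation of a decomposition. *)
Lemma comul_tree_decomposes d :
  decomposes (cofree_lift d)
    [seq (cofree_lift p.1, cofree_lift p.2) | p <- comul_summands d].
Proof.
move=> t u; rewrite rep_of_val comul_tree_node big_map.
by apply: eq_bigr => p _; rewrite !rep_of_val.
Qed.

Lemma cofree_lift_root d : rep_root (cofree_lift d) = (phi d, pc_counit D d).
Proof.
by rewrite /rep_root rep_of_val comul_tree_leaf tpow1_pure /thead (tnth_nth 0).
Qed.

Lemma cofree_lift_morphism :
  @precoalgebra_morphism K D (rep_precoalgebra ind) cofree_lift.
Proof.
split=> d; last by rewrite /= /rep_counit_fun cofree_lift_root.
rewrite [pc_comul D d]summandsE tensor_map_sum.
rewrite -[LHS]/(comul_fun (cofree_lift d)).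
rewrite (comul_funE ind (comul_tree_decomposes d)).
by rewrite /family_tensor big_map.
Qed.

(** Induction on the grading tree. At [Leaf] the value is the pair of the
    projection and the counit; at a composite tree, each morphism expresses it
    through the same summands of the coproduct in [D]. *)
Lemma morphism_val_unique (psi chi : {linear D -> rep V}) :
  @precoalgebra_morphism K D (rep_precoalgebra ind) psi ->
  @precoalgebra_morphism K D (rep_precoalgebra ind) chi ->
  (forall d, rep_proj V (psi d) = rep_proj V (chi d)) ->
  forall t d, rep_val (psi d) t = rep_val (chi d) t.
Proof.
move=> [psiM psi1] [chiM chi1] pichi.
have node (xi : {linear D -> rep V}) d t u :
    comul_fun (xi d) = tensor_map xi xi (pc_comul D d) ->
    rep_val (xi d) (Node t u) = \sum_(p <- comul_summands d)
      tmul (rep_val (xi p.1) t) (rep_val (xi p.2) u).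
  rewrite {1}[pc_comul D d]summandsE tensor_map_sum => E.
  rewrite (@rep_val_node _ _ ind _
    [seq (xi p.1, xi p.2) | p <- comul_summands d]) ?big_map //.
  by rewrite E /family_tensor big_map.
elim=> [|t IHt u IHu] d.
  apply: tpow1_inj; rewrite -!/(rep_root _).
  rewrite [LHS]surjective_pairing [RHS]surjective_pairing; congr (_, _).
    exact: pichi.
  exact: etrans (psi1 d) (esym (chi1 d)).
rewrite !node; [|exact: chiM|exact: psiM].
by apply: eq_bigr => p _; rewrite IHt IHu.
Qed.

End Cofree.

Theorem theorem18 (K : comPzRingType) (V : lmodType K)
    (ind : comul_independent V) :
  @cofree_over K V (rep_precoalgebra ind) (rep_proj V).
Proof.
move=> D phi; exists (cofree_lift phi).
have piE d : rep_proj V (cofree_lift phi d) = phi d.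
  by rewrite /= /rep_proj_fun cofree_lift_root.
split=> [|//|psi psiM psipi d]; first exact: cofree_lift_morphism.
apply: rep_ext => t; apply: (morphism_val_unique psiM) => [|x].
  exact: cofree_lift_morphism.
by rewrite piE; exact: psipi.
Qed.
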